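(* Let $K$ be a field with $\mathrm{char}(K)\neq 2$ containing an element $\mathbf{i}$ with $\mathbf{i}^2=-1$. Let $a,b$ be nonzero elements of $K$ with $a\neq\pm b$ and $a\neq\pm\mathbf{i}b$, and consider the elliptic curve $E_{a,b}: y^2=(x-\alpha_1)(x-\alpha_2)(x-\alpha_3)$ over $K$ with $\alpha_1=(a^2-b^2)^2$, $\alpha_2=(a^2+b^2)^2$, $\alpha_3=0$. Then every point of order $2$ on $E_{a,b}$ is divisible by $2$ in $E_{a,b}(K)$, i.e., $E_{a,b}(K)$ contains all twelve points of order $4$. In particular, $E_{a,b}(K)$ contains a subgroup isomorphic to $\mathbb{Z}/4\mathbb{Z}\oplus\mathbb{Z}/4\mathbb{Z}$. *)

(* Defs.v *)
From HB Require Import structures.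
From mathcomp Require Import all_boot all_order all_algebra.
From mathcomp Require Import ring.

Set Implicit Arguments.
Unset Strict Implicit.
Unset Printing Implicit Defensive.

Import GRing.Theory.
Local Open Scope ring_scope.

(* The elliptic curve y^2 = (x - e1)(x - e2)(x - e3): in characteristic other
   than 2, this plane cubic is smooth exactly when the e_i are distinct. *)
Record ellcurve (K : fieldType) := EllCurve {
  ec1 : K; ec2 : K; ec3 : K;
  ec_char : 2%N \notin [pchar K];
  ec_uniq : uniq [:: ec1; ec2; ec3]
}.

Section RawPoints.

Variables (K : fieldType) (E : ellcurve K).

Definition ec_cubic (x : K) : K := (x - ec1 E) * (x - ec2 E) * (x - ec3 E).

Definition ec_cubic_deriv (x : K) : K :=
  (x - ec2 E) * (x - ec3 E) + (x - ec1 E) * (x - ec3 E)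
  + (x - ec1 E) * (x - ec2 E).

(* [None] is the point at infinity, [Some (x, y)] an affine point. *)
Definition on_curve (p : option (K * K)) : bool :=
  if p is Some (x, y) then y ^+ 2 == ec_cubic x else true.

Definition raw_opp (p : option (K * K)) : option (K * K) :=
  if p is Some (x, y) then Some (x, - y) else None.

(* If the line of slope [l] through [(x1, y1)] meets the curve at abscissas
   [x1] and [x2], this is the opposite of its third intersection point. *)
Definition raw_third (x1 y1 x2 l : K) : K * K :=
  let x3 := l ^+ 2 + (ec1 E + ec2 E + ec3 E) - x1 - x2 in
  (x3, - (y1 + l * (x3 - x1))).

Definition raw_add (p q : option (K * K)) : option (K * K) :=
  match p, q with
  | None, _ => q
  | _, None => p
  | Some (x1, y1), Some (x2, y2) =>
    if x1 == x2 then
      if y1 == - y2 then None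
      else Some (raw_third x1 y1 x2 (ec_cubic_deriv x1 / (y1 *+ 2)))
    else Some (raw_third x1 y1 x2 ((y2 - y1) / (x2 - x1)))
  end.

Lemma ec_two_neq0 : 2%:R != 0 :> K.
Proof. by apply: contra (ec_char E) => h; rewrite inE /= h. Qed.

(* [cubic - line^2 = (x - x1)(x - x2)(x - x3)], coefficientwise. *)
Definition is_line (x1 y1 x2 y2 l x3 y3 : K) : Prop :=
  [/\ y2 = y1 + l * (x2 - x1),
      y3 = - (y1 + l * (x3 - x1)),
      ec1 E + ec2 E + ec3 E = x1 + x2 + x3 - l ^+ 2,
      ec1 E * ec2 E + ec1 E * ec3 E + ec2 E * ec3 E =
        x1 * x2 + x1 * x3 + x2 * x3 + l * (y1 - l * x1) *+ 2 &
      ec1 E * ec2 E * ec3 E = x1 * x2 * x3 - (y1 - l * x1) ^+ 2].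

Lemma is_line_cubic x1 y1 x2 y2 l x3 y3 : is_line x1 y1 x2 y2 l x3 y3 ->
  forall x, ec_cubic x =
    (y1 + l * (x - x1)) ^+ 2 + (x - x1) * (x - x2) * (x - x3).
Proof.
case=> _ _ h1 h2 h3 x; rewrite /ec_cubic.
have -> : (x - ec1 E) * (x - ec2 E) * (x - ec3 E) =
  x ^+ 3 - (ec1 E + ec2 E + ec3 E) * x ^+ 2
  + (ec1 E * ec2 E + ec1 E * ec3 E + ec2 E * ec3 E) * x
  - ec1 E * ec2 E * ec3 E by ring.
by rewrite h1 h2 h3; ring.
Qed.

Lemma is_line_curve x1 y1 x2 y2 l x3 y3 :
  is_line x1 y1 x2 y2 l x3 y3 -> on_curve (Some (x3, y3)).
Proof.
move=> h; rewrite /= (is_line_cubic h) subrr mulr0 addr0.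
by case: h => _ -> *; rewrite sqrrN.
Qed.

Lemma on_curve_y x y1 y2 : on_curve (Some (x, y1)) -> on_curve (Some (x, y2)) ->
  y1 != - y2 -> y1 = y2.
Proof.
move=> /eqP h1 /eqP h2 h; apply/eqP.
have : (y1 - y2) * (y1 + y2) == 0 by rewrite -subr_sqr h1 h2 subrr.
by rewrite mulf_eq0 subr_eq0 addr_eq0 (negPf h) orbF.
Qed.

Lemma opp_eq0 (y : K) : (y == - y) = (y == 0).
Proof.
by rewrite -addr_eq0 -mulr2n -mulr_natl mulf_eq0 (negPf ec_two_neq0).
Qed.

Lemma y2_neq0 (y : K) : y != - y -> y *+ 2 != 0.
Proof. by rewrite opp_eq0 => h; rewrite -mulr_natl mulf_neq0 ?ec_two_neq0. Qed.

Lemma raw_addP x1 y1 x2 y2 :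
    on_curve (Some (x1, y1)) -> on_curve (Some (x2, y2)) ->
    ~~ ((x1 == x2) && (y1 == - y2)) ->
  exists l, exists x3, exists y3, is_line x1 y1 x2 y2 l x3 y3 /\
    raw_add (Some (x1, y1)) (Some (x2, y2)) = Some (x3, y3).
Proof.
move=> h1 h2; rewrite /raw_add.
have [e|ne] /= := eqVneq x1 x2.
  move=> ny; rewrite (negPf ny).
  rewrite -{}e in h2 *; have e := on_curve_y h1 h2 ny.
  rewrite -{}e in h2 ny *; have y0 := y2_neq0 ny.
  set l := _ / _.
  have hl : l * (y1 *+ 2) = ec_cubic_deriv x1 by rewrite divfK.
  exists l, (raw_third x1 y1 x1 l).1, (raw_third x1 y1 x1 l).2; split=> //.
  move: h1 hl; rewrite /ec_cubic_deriv /= /ec_cubic => /eqP h1 hl.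
  split=> //; first by ring.
  - by ring.
  - apply/eqP; rewrite -subr_eq0; apply/eqP.
    by transitivity (ec_cubic_deriv x1 - l * (y1 *+ 2));
      [rewrite /ec_cubic_deriv; ring | rewrite hl subrr].
  - apply/eqP; rewrite -subr_eq0; apply/eqP.
    transitivity (y1 ^+ 2 - ec_cubic x1
      + x1 * (ec_cubic_deriv x1 - l * (y1 *+ 2))).
      by rewrite /ec_cubic_deriv /ec_cubic; ring.
    by rewrite h1 hl !subrr mulr0 addr0.
move=> _; set l := _ / _.
have d0 : x2 - x1 != 0 by rewrite subr_eq0 eq_sym.
have hl : y2 = y1 + l * (x2 - x1) by rewrite divfK // addrC subrK.
exists l, (raw_third x1 y1 x2 l).1, (raw_third x1 y1 x2 l).2; split=> //.
have := h2; rewrite hl.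
move: h1; rewrite /= /ec_cubic => /eqP h1 /eqP h3.
have hq : ec1 E * ec2 E + ec1 E * ec3 E + ec2 E * ec3 E =
  x1 * x2 + x1 * (raw_third x1 y1 x2 l).1 + x2 * (raw_third x1 y1 x2 l).1
  + l * (y1 - l * x1) *+ 2.
  apply: (mulIf d0); apply/eqP; rewrite -subr_eq0; apply/eqP.
  transitivity (y1 ^+ 2 - (x1 - ec1 E) * (x1 - ec2 E) * (x1 - ec3 E)
   - ((y1 + l * (x2 - x1)) ^+ 2
     - (x2 - ec1 E) * (x2 - ec2 E) * (x2 - ec3 E))); first by rewrite /=; ring.
  by rewrite h1 h3 !subrr.
split=> //; first by rewrite /=; ring.
apply/eqP; rewrite -subr_eq0; apply/eqP.
transitivity ((y1 ^+ 2 - (x1 - ec1 E) * (x1 - ec2 E) * (x1 - ec3 E))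
  + x1 * ((ec1 E * ec2 E + ec1 E * ec3 E + ec2 E * ec3 E) -
  (x1 * x2 + x1 * (raw_third x1 y1 x2 l).1 + x2 * (raw_third x1 y1 x2 l).1
  + l * (y1 - l * x1) *+ 2))); first by rewrite /=; ring.
by rewrite h1 hq !subrr mulr0 addr0.
Qed.

Lemma is_line_add x1 y1 x2 y2 l x3 y3 : is_line x1 y1 x2 y2 l x3 y3 ->
    ~~ ((x1 == x2) && (y1 == - y2)) ->
  raw_add (Some (x1, y1)) (Some (x2, y2)) = Some (x3, y3).
Proof.
case=> hy2 hy3 h1 h2 h3; rewrite /raw_add.
have hx3 : x3 = l ^+ 2 + (ec1 E + ec2 E + ec3 E) - x1 - x2 by rewrite h1; ring.
have [e|ne] /= := eqVneq x1 x2.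
  move=> ny; rewrite (negPf ny).
  have ey : y2 = y1 by rewrite hy2 e subrr mulr0 addr0.
  rewrite ey in ny; have y0 := y2_neq0 ny.
  suff -> : ec_cubic_deriv x1 / (y1 *+ 2) = l.
    by rewrite /raw_third -hx3 hy3.
  apply: (mulIf y0); rewrite divfK //.
  have -> : ec_cubic_deriv x1 = x1 ^+ 2 *+ 3
     - (ec1 E + ec2 E + ec3 E) * x1 *+ 2
     + (ec1 E * ec2 E + ec1 E * ec3 E + ec2 E * ec3 E).
    by rewrite /ec_cubic_deriv; ring.
  by rewrite h1 h2 -e; ring.
move=> _; have d0 : x2 - x1 != 0 by rewrite subr_eq0 eq_sym.
suff -> : (y2 - y1) / (x2 - x1) = l by rewrite /raw_third -hx3 hy3.
by apply: (mulIf d0); rewrite divfK // hy2 addrC addKr.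
Qed.

Lemma on_curve_opp p : on_curve p -> on_curve (raw_opp p).
Proof. by case: p => [[x y]|] //=; rewrite sqrrN. Qed.

Lemma on_curve_add p q : on_curve p -> on_curve q -> on_curve (raw_add p q).
Proof.
case: p => [[x1 y1]|] //; case: q => [[x2 y2]|] // h1 h2.
have [/andP[/eqP e1 /eqP e2]|h] := boolP ((x1 == x2) && (y1 == - y2)).
  by rewrite /raw_add e1 e2 !eqxx.
have [l [x3 [y3 [hl ->]]]] := raw_addP h1 h2 h.
exact: is_line_curve hl.
Qed.

Lemma is_lineC x1 y1 x2 y2 l x3 y3 :
  is_line x1 y1 x2 y2 l x3 y3 -> is_line x2 y2 x1 y1 l x3 y3.
Proof.
by case=> -> -> h1 h2 h3; split; rewrite ?h1 ?h2 ?h3; ring.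
Qed.

Lemma is_lineN x1 y1 x2 y2 l x3 y3 :
  is_line x1 y1 x2 y2 l x3 y3 ->
  is_line x1 (- y1) x3 y3 (- l) x2 y2.
Proof.
by case=> -> -> h1 h2 h3; split; rewrite ?h1 ?h2 ?h3; ring.
Qed.

Lemma is_lineNN x1 y1 x2 y2 l x3 y3 :
  is_line x1 y1 x2 y2 l x3 y3 ->
  is_line x1 (- y1) x2 (- y2) (- l) x3 (- y3).
Proof.
by case=> -> -> h1 h2 h3; split; rewrite ?h1 ?h2 ?h3; ring.
Qed.

Lemma raw_add0 p : raw_add None p = p. Proof. by []. Qed.

Lemma raw_addp0 p : raw_add p None = p. Proof. by case: p => [[]|]. Qed.

Lemma raw_addN p : raw_add (raw_opp p) p = None.
Proof. by case: p => [[x y]|] //=; rewrite !eqxx. Qed.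

Lemma raw_oppK p : raw_opp (raw_opp p) = p.
Proof. by case: p => [[x y]|] //=; rewrite opprK. Qed.

Lemma raw_addC p q : on_curve p -> on_curve q -> raw_add p q = raw_add q p.
Proof.
case: p => [[x1 y1]|] //; case: q => [[x2 y2]|] // h1 h2.
have [/andP[/eqP e1 /eqP e2]|h] := boolP ((x1 == x2) && (y1 == - y2)).
  by rewrite /raw_add e1 e2 opprK !eqxx.
have [l [x3 [y3 [hl ->]]]] := raw_addP h1 h2 h.
rewrite (is_line_add (is_lineC hl)) // eq_sym.
by apply: contra h => /andP[-> /eqP ->]; rewrite opprK eqxx.
Qed.

Lemma raw_addNN p q : on_curve p -> on_curve q ->
  raw_add (raw_opp p) (raw_opp q) = raw_opp (raw_add p q).
Proof.
case: p => [[x1 y1]|] //; case: q => [[x2 y2]|] // h1 h2.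
have [/andP[/eqP e1 /eqP e2]|h] := boolP ((x1 == x2) && (y1 == - y2)).
  by rewrite /raw_add /raw_opp e1 e2 !eqxx.
have [l [x3 [y3 [hl ->]]]] := raw_addP h1 h2 h.
by rewrite /= in h *; rewrite -[LHS]/(raw_add (Some (x1, - y1)) (Some (x2, - y2)))
  (is_line_add (is_lineNN hl)) // eqr_opp.
Qed.

Lemma raw_addKN p q : on_curve p -> on_curve q ->
  raw_add (raw_opp p) (raw_add p q) = q.
Proof.
case: p => [[x1 y1]|] //; case: q => [[x2 y2]|]; last first.
  by move=> *; rewrite raw_addp0 raw_addN.
move=> h1 h2.
have [/andP[/eqP e1 /eqP e2]|h] := boolP ((x1 == x2) && (y1 == - y2)).
  by rewrite /raw_add /raw_opp e1 e2 opprK !eqxx.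
have [l [x3 [y3 [hl ->]]]] := raw_addP h1 h2 h.
rewrite (is_line_add (is_lineN hl)) //; apply/negP.
rewrite eqr_opp => /andP[/eqP ex /eqP ey].
have ey1 : y1 = 0.
  apply/eqP; rewrite -opp_eq0; apply/eqP.
  by case: hl => _ hy3 *; rewrite {1}ey hy3 -ex subrr mulr0 addr0.
have c0 : ec_cubic x1 = 0 by move/eqP: h1 => /= <-; rewrite ey1 expr0n.
have d0 : ec_cubic_deriv x1 = 0.
  have -> : ec_cubic_deriv x1 = x1 ^+ 2 *+ 3
     - (ec1 E + ec2 E + ec3 E) * x1 *+ 2
     + (ec1 E * ec2 E + ec1 E * ec3 E + ec2 E * ec3 E).
    by rewrite /ec_cubic_deriv; ring.
  by case: hl => _ _ -> -> _; rewrite -ex ey1; ring.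
move: (ec_uniq E) c0 d0; rewrite /= !inE negb_or /ec_cubic /ec_cubic_deriv.
case/and3P => /andP[n12 n13] n23 _ /eqP.
rewrite !mulf_eq0 !subr_eq0 -orbA => /or3P[] /eqP -> /eqP;
  rewrite subrr ?(mul0r, mulr0, addr0, add0r) mulf_eq0 !subr_eq0.
- by rewrite (negPf n12) (negPf n13).
- by rewrite eq_sym (negPf n12) (negPf n23).
- by rewrite ![ec3 E == _]eq_sym (negPf n13) (negPf n23).
Qed.

Lemma raw_addA p q r : on_curve p -> on_curve q -> on_curve r ->
  raw_add p (raw_add q r) = raw_add (raw_add p q) r.
Proof.
move=> hp hq hr.
have [epq|npq] := eqVneq p (raw_opp q).
  rewrite epq raw_addN raw_addKN //.
have [eqr|nqr] := eqVneq q (raw_opp r).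
  have hr' := on_curve_opp hr.
  rewrite eqr raw_addN raw_addp0 (raw_addC hp) // raw_addC ?on_curve_add //.
  by rewrite -{1}[r]raw_oppK raw_addKN.
have hpq := on_curve_add hp hq; have hqr := on_curve_add hq hr.
have [eA|nA] := eqVneq (raw_add p q) (raw_opp r).
  rewrite eA raw_addN -[r]raw_oppK -eA -raw_addNN // (raw_addC (p := raw_opp p));
    rewrite ?on_curve_opp //.
  have -> : raw_add q (raw_add (raw_opp q) (raw_opp p)) = raw_opp p.
    by rewrite -{1}[q]raw_oppK raw_addKN // on_curve_opp.
  by rewrite raw_addC ?raw_addN // on_curve_opp.
have [eB|nB] := eqVneq p (raw_opp (raw_add q r)).
  rewrite eB raw_addN -raw_addNN // (raw_addC (p := raw_opp q));
    rewrite ?on_curve_opp //.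
  rewrite [X in raw_add X r]raw_addC ?on_curve_add ?on_curve_opp //.
  rewrite [raw_add (raw_opp r) _]raw_addC ?on_curve_opp //.
  by rewrite -{1}[q]raw_oppK raw_addKN ?on_curve_opp // raw_addN.
have [epr|npr] := eqVneq p r.
  by rewrite epr raw_addC // (raw_addC hq).
case: p => [[x1 y1]|] // in hp npq hpq nA nB npr *.
case: q => [[x2 y2]|] // in hq npq hpq nqr hqr nA nB *.
case: r => [[x3 y3]|] // in hr nqr hqr nA nB npr *; last first.
  by rewrite !raw_addp0.
have [l [xA [yA [hl eA]]]] := raw_addP hp hq npq.
have [k [xB [yB [hk eB]]]] := raw_addP hq hr nqr.
rewrite eA in nA *; rewrite eB in nB *.
case: (hl) => l1 l2 l3 l4 l5; case: (hk) => k1 k2 k3 k4 k5.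
have ly1 : y1 = y2 + l * (x1 - x2) by rewrite l1; ring.
have lyA : yA = - (y2 + l * (xA - x2)) by rewrite l2 l1; ring.
pose t := k - l.
have E1 : x3 + xB - x1 - xA = t * (l + k).
  apply/eqP; rewrite -subr_eq0; apply/eqP.
  transitivity ((x2 + x3 + xB - k ^+ 2) - (x1 + x2 + xA - l ^+ 2)).
    by rewrite /t; ring.
  by rewrite -l3 -k3 subrr.
have E2 : x3 * xB - x1 * xA = - (t * (y2 *+ 2 - (l + k) * x2)).
  apply/eqP; rewrite -subr_eq0; apply/eqP.
  transitivity ((x2 * x3 + x2 * xB + x3 * xB + k * (y2 - k * x2) *+ 2)
    - (x1 * x2 + x1 * xA + x2 * xA + l * (y1 - l * x1) *+ 2)
    - x2 * ((x2 + x3 + xB - k ^+ 2) - (x1 + x2 + xA - l ^+ 2))).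
    by rewrite ly1 /t; ring.
  by rewrite -l3 -k3 -l4 -k4 !subrr mulr0 subrr.
have [t0|tn0] := eqVneq t 0.
  move: E1 E2; rewrite t0 !mul0r oppr0 => E1 E2.
  have ek : k = l by apply/eqP; rewrite -subr_eq0 -/t t0.
  have : (x1 - x3) * (x1 - xB) == 0.
    apply/eqP; transitivity (- x1 * (x3 + xB - x1 - xA) + (x3 * xB - x1 * xA)).
      by ring.
    by rewrite E1 E2 mulr0 addr0.
  rewrite mulf_eq0 !subr_eq0 => /orP[] /eqP ex.
    case/eqP: npr; congr (Some (_, _)) => //.
    by rewrite ly1 k1 ek ex.
  case/eqP: nB; rewrite /= -ex; congr (Some (_, _)).
  by rewrite k2 opprK ek -ex ly1.
have ek : k = l + t by rewrite /t; ring.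
have [c hc] : exists c, x3 = x1 + c * t.
  by exists ((x3 - x1) / t); rewrite divfK // addrC subrK.
have hxB : xB = x1 + xA - x3 + t * (l + k) by rewrite -E1; ring.
pose m := c - l; pose n := c - k.
pose xS := m ^+ 2 - l ^+ 2 + x1 + x2 - x3.
pose yS := - (y3 + m * (xS - x3)).
have two0 := ec_two_neq0.
have ey2 : y2 = ((l + k) * x2 - x1 * (l + k - c) - c * xB) / 2%:R.
  apply: (mulIf two0); rewrite divfK //; apply: (mulfI tn0).
  apply/eqP; rewrite -subr_eq0; apply/eqP.
  transitivity (t * (y2 *+ 2 - (l + k) * x2) + (x3 * xB - x1 * xA)).
    by rewrite hxB hc; ring.
  by rewrite E2 addrN.
have hm : is_line xA yA x3 y3 m xS yS.
  rewrite /is_line l3 l4 l5 /yS /xS /m k1 lyA ly1 ey2 hxB hc ek.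
  by split; field.
have hn : is_line x1 y1 xB yB n xS yS.
  rewrite /is_line l3 l4 l5 /yS /xS /m /n k2 k1 ly1 ey2 hxB hc ek.
  by split; field.
by rewrite (is_line_add hm) // (is_line_add hn).
Qed.

End RawPoints.

Record ecpoint (K : fieldType) (E : ellcurve K) := ECPoint {
  ecval : option (K * K);
  ecvalP : on_curve E ecval
}.

Section PointGroup.

Variables (K : fieldType) (E : ellcurve K).
Implicit Types P Q R : ecpoint E.

HB.instance Definition _ := [isSub for @ecval K E].
HB.instance Definition _ := [Choice of ecpoint E by <:].

Definition ec_zero : ecpoint E := ECPoint (isT : on_curve E None).
Definition ec_opp P : ecpoint E := ECPoint (on_curve_opp (ecvalP P)).
Definition ec_add P Q : ecpoint E :=
  ECPoint (on_curve_add (ecvalP P) (ecvalP Q)).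

Lemma ec_addA : associative ec_add.
Proof. by move=> P Q R; apply/val_inj/raw_addA; apply: ecvalP. Qed.

Lemma ec_addC : commutative ec_add.
Proof. by move=> P Q; apply/val_inj/raw_addC; apply: ecvalP. Qed.

Lemma ec_add0 : left_id ec_zero ec_add.
Proof. by move=> P; apply/val_inj. Qed.

Lemma ec_addN : left_inverse ec_zero ec_opp ec_add.
Proof. by move=> P; apply/val_inj/raw_addN. Qed.

HB.instance Definition _ :=
  GRing.isZmodule.Build (ecpoint E) ec_addA ec_addC ec_add0 ec_addN.

End PointGroup.

Definition has_order (V : zmodType) (v : V) (n : nat) : Prop :=
  [/\ (0 < n)%N, v *+ n = 0 & forall m : nat, (0 < m < n)%N -> v *+ m != 0].

Section BaseChange.

Variables (K L : fieldType) (iota : {rmorphism K -> L}) (E : ellcurve K).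

Lemma base_change_char : 2%N \notin [pchar L].
Proof. by rewrite (fmorph_pchar iota) ec_char. Qed.

Lemma base_change_uniq :
  uniq [:: iota (ec1 E); iota (ec2 E); iota (ec3 E)].
Proof.
rewrite -[X in uniq X]/(map iota [:: ec1 E; ec2 E; ec3 E]).
by rewrite (map_inj_uniq (fmorph_inj iota)) ec_uniq.
Qed.

Definition base_change : ellcurve L :=
  EllCurve base_change_char base_change_uniq.

Definition raw_map (p : option (K * K)) : option (L * L) :=
  if p is Some (x, y) then Some (iota x, iota y) else None.

Lemma on_curve_map p : on_curve E p -> on_curve base_change (raw_map p).
Proof.
case: p => [[x y]|] //= /eqP h.
by rewrite -rmorphXn h /ec_cubic !rmorphM !rmorphB.
Qed.

Definition ec_map (P : ecpoint E) : ecpoint base_change :=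
  ECPoint (on_curve_map (ecvalP P)).

End BaseChange.

Section Eab.

Variables (K : fieldType) (i a b : K).
Hypotheses (charK : 2%N \notin [pchar K]) (hi : i ^+ 2 = -1).
Hypotheses (a0 : a != 0) (b0 : b != 0) (hab : a != b) (haNb : a != - b).
Hypotheses (haib : a != i * b) (haNib : a != - (i * b)).

Lemma Eab_uniq : uniq [:: (a ^+ 2 - b ^+ 2) ^+ 2; (a ^+ 2 + b ^+ 2) ^+ 2; 0].
Proof.
have two0 : 2%:R != 0 :> K by apply: contra charK => h; rewrite inE /= h.
have em : a ^+ 2 - b ^+ 2 != 0.
  by rewrite subr_sqr mulf_neq0 // ?subr_eq0 ?addr_eq0.
have ep : a ^+ 2 + b ^+ 2 != 0.
  have -> : a ^+ 2 + b ^+ 2 = a ^+ 2 - (i * b) ^+ 2.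
    by rewrite exprMn hi mulN1r opprK.
  by rewrite subr_sqr mulf_neq0 // ?subr_eq0 ?addr_eq0.
rewrite /= !inE !negb_or !expf_neq0 // !andbT -subr_eq0.
have -> : (a ^+ 2 - b ^+ 2) ^+ 2 - (a ^+ 2 + b ^+ 2) ^+ 2
  = - (2%:R * a * (2%:R * a) * b ^+ 2) by ring.
by rewrite oppr_eq0 !mulf_neq0 // expf_neq0.
Qed.

Definition Eab : ellcurve K := EllCurve charK Eab_uniq.

End Eab.

(* Main.v *)
(* If r^2 = e - f and s^2 = e - g, the tangent to y^2 = (x - e)(x - f)(x - g) at
   (e + r s, r s (r + s)) has slope r + s and meets the curve again at (e, 0), so
   this point is a half of (e, 0).  On E_{a,b} the differences alpha_j - alpha_k
   are squares, which yields points Q1 and Q2 of order 4 whose doubles generate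
   the 2-torsion.  They define an injection of Z/4 + Z/4 into E(K).  Over any
   extension L the 2-torsion is still {0, 2 Q1, 2 Q2, 2 Q1 + 2 Q2}: hence if
   4 R = 0 then 2 R = 2 Q for some Q in the image of Z/4 + Z/4, and R - Q, being
   2-torsion, lies in this image as well. *)

Require Import Defs.
From HB Require Import structures.
From mathcomp Require Import all_boot all_order all_algebra.
From mathcomp Require Import ring.

Set Implicit Arguments.
Unset Strict Implicit.
Unset Printing Implicit Defensive.

Import GRing.Theory.
Local Open Scope ring_scope.

(** * Multiples and orders in abelian groups *)

Lemma mulrn_modn (V : zmodType) (v : V) (n m : nat) :
  v *+ n = 0 -> v *+ (m %% n) = v *+ m.
Proof.
by move=> h; rewrite {2}(divn_eq m n) mulrnDr mulnC mulrnA h mul0rn add0r.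
Qed.

Lemma has_order_inj (U V : zmodType) (f : {additive U -> V}) (u : U) (n : nat) :
  injective f -> has_order (f u) n <-> has_order u n.
Proof.
move=> inj_f; have f0 v : (f v == 0) = (v == 0).
  by rewrite -(inj_eq inj_f) raddf0.
split=> -[n0 un nz]; split=> // [|m /nz].
- by apply/eqP; rewrite -f0 raddfMn un.
- by rewrite -raddfMn f0.
- by rewrite -raddfMn un raddf0.
- by rewrite -raddfMn f0.
Qed.

Lemma has_order4P (V : zmodType) (v : V) :
  has_order v 4 <-> v *+ 4 = 0 /\ v *+ 2 != 0.
Proof.
split=> [[_ v4 nz]|[v4 v2]]; first by split; last exact: nz.
split=> // m /andP[m0 m4]; apply: contra v2 => /eqP vm.
case: m m0 m4 vm => [|[|[|[|]]]] //= _ _ vm.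
- by rewrite mulr1n in vm; rewrite vm mul0rn.
- by rewrite vm.
- by move: v4; rewrite mulrSr vm add0r => ->; rewrite mul0rn.
Qed.

(** * Embedding Z/4 + Z/4 into an abelian group *)

Section Z4Z4.

Variables (V : zmodType) (v w : V).
Hypotheses (v4 : v *+ 4 = 0) (w4 : w *+ 4 = 0).

Lemma Z4Z4_additive :
  exists f : {additive ('Z_4 * 'Z_4)%type -> V},
    forall u, f u = v *+ u.1 + w *+ u.2.
Proof.
pose f (u : 'Z_4 * 'Z_4) := v *+ u.1 + w *+ u.2.
have mulrn_sub (x : V) (m n : 'Z_4) : x *+ 4 = 0 ->
    x *+ (m - n)%R + x *+ n = x *+ m.
  (* A sum in ['Z_4] is the sum of the representatives reduced modulo 4, and [x *+ 4 = 0] absorbs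
     the reduction. *)
  by move=> x4; rewrite -mulrnDr -[LHS](mulrn_modn _ x4) -[in RHS](subrK n m).
have f_sub : zmod_morphism f.
  move=> u u'; apply: (canRL (addrK _)).
  by rewrite /f addrACA !mulrn_sub.
by exists (HB.pack_for {additive ('Z_4 * 'Z_4)%type -> V} f
             (GRing.isZmodMorphism.Build _ _ f f_sub)).
Qed.

Hypotheses (v2 : v *+ 2 != 0) (w2 : w *+ 2 != 0).
Hypothesis vw2 : v *+ 2 + w *+ 2 != 0.

Lemma double_comb_even (m n : nat) :
  v *+ 2 *+ m + w *+ 2 *+ n = 0 -> ~~ odd m && ~~ odd n.
Proof.
have mod2 (x : V) k : x *+ 4 = 0 -> x *+ 2 *+ k = x *+ 2 *+ odd k.
  by move=> x4; rewrite -(@mulrn_modn _ _ 2 k) ?modn2 // -mulrnA.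
rewrite (mod2 _ m v4) (mod2 _ n w4) => /eqP; case: (odd m) (odd n) => [] [] //=.
- by rewrite !mulr1n (negPf vw2).
- by rewrite mulr1n mulr0n addr0 (negPf v2).
- by rewrite mulr1n mulr0n add0r (negPf w2).
Qed.

(** Parity is used twice: doubling the relation shows that [m] and [n] are even; the relation
    itself, read in terms of [v *+ 2] and [w *+ 2], then shows that their halves are even. *)
Lemma Z4Z4_comb_eq0 (m n : 'Z_4) : v *+ m + w *+ n = 0 -> (m, n) = (0, 0).
Proof.
move=> h; have /andP[em en] : ~~ odd m && ~~ odd n.
  by apply: double_comb_even; rewrite -!mulrnA !(mulnC 2) !mulrnA -mulrnDl h mul0rn.
have : ~~ odd m./2 && ~~ odd n./2.
  by apply: double_comb_even; rewrite -!mulrnA !mul2n !even_halfK.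
by case: m n em en {h} => [[|[|[|[|]]]] // hm] [[|[|[|[|]]]] // hn] //= _ _ _;
  congr (_, _); apply: val_inj.
Qed.

Lemma Z4Z4_embedding :
  exists f : {additive ('Z_4 * 'Z_4)%type -> V},
    [/\ injective f, f (1, 0) = v & f (0, 1) = w].
Proof.
have [f fE] := Z4Z4_additive; exists f; split; rewrite ?fE ?addr0 ?add0r //.
by apply: raddf_inj => -[m n]; rewrite fE => /Z4Z4_comb_eq0.
Qed.

End Z4Z4.

(** * Two-torsion and halving on a general curve *)

Section Curve.

Variables (K : fieldType) (E : ellcurve K).

Lemma ec_torsion2 (P : ecpoint E) : P *+ 2 = 0 ->
  ecval P \in [:: None; Some (ec1 E, 0); Some (ec2 E, 0); Some (ec3 E, 0)].
Proof.
rewrite mulr2n => /(congr1 (@ecval _ _)) /=.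
case: P => [[[x y]|]] //= hP; rewrite eqxx (opp_eq0 E).
have [y0 _|//] := eqVneq y 0.
move: hP; rewrite y0 /ec_cubic expr0n /= eq_sym !mulf_eq0 !subr_eq0 -orbA.
by case/or3P => /eqP ->; rewrite !inE eqxx ?orbT.
Qed.

(** Matching symmetric functions let [e, f, g] be the roots in any order, in the form that [is_line]
    needs. *)
Lemma ec_halve (e f g r s : K) :
    ec1 E + ec2 E + ec3 E = e + f + g ->
    ec1 E * ec2 E + ec1 E * ec3 E + ec2 E * ec3 E = e * f + e * g + f * g ->
    ec1 E * ec2 E * ec3 E = e * f * g ->
    r ^+ 2 = e - f -> s ^+ 2 = e - g -> uniq [:: e; f; g] ->
  exists Q : ecpoint E, ecval (Q *+ 2) = Some (e, 0).
Proof.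
move=> s1 s2 s3 hr hs.
have ef : f = e - r ^+ 2 by rewrite hr; ring.
have eg : g = e - s ^+ 2 by rewrite hs; ring.
rewrite /= !inE negb_or andbT => /andP[/andP[nef neg] nfg].
pose x := e + r * s; pose y := r * s * (r + s).
have line : is_line E x y x y (r + s) e 0.
  by split; rewrite ?s1 ?s2 ?s3 ?ef ?eg /x /y; ring.
have xy : on_curve E (Some (x, y)).
  by rewrite /= (is_line_cubic line) subrr !(mul0r, mulr0) !addr0.
(* The factors [r], [s] and [r + s] vanish only if [e = f], [e = g] and [f = g] respectively. *)
have y0 : y != 0.
  apply/negP; rewrite /y !mulf_eq0 -orbA addr_eq0 => /or3P[] /eqP h.
  - by case/eqP: nef; rewrite ef h; ring.
  - by case/eqP: neg; rewrite eg h; ring.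
  - by case/eqP: nfg; rewrite ef eg h; ring.
exists (ECPoint xy); rewrite -[LHS]/(raw_add E (Some (x, y)) (Some (x, y))).
by apply: (is_line_add line); rewrite eqxx (opp_eq0 E).
Qed.

(** The line y = 0 meets the curve at the three roots. *)
Lemma ec_add_order2 (P Q : ecpoint E) :
    ecval P = Some (ec1 E, 0) -> ecval Q = Some (ec2 E, 0) ->
  ecval (P + Q) = Some (ec3 E, 0).
Proof.
move=> hP hQ; rewrite -[LHS]/(raw_add E (ecval P) (ecval Q)) hP hQ.
have line : is_line E (ec1 E) 0 (ec2 E) 0 0 (ec3 E) 0 by split; ring.
apply: (is_line_add line).
by have := ec_uniq E; rewrite /= inE negb_or => /andP[/andP[/negPf->]].
Qed.

(** * Base change as an injective homomorphism *)

Variables (L : fieldType) (iota : {rmorphism K -> L}).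

Lemma raw_map_add (p q : option (K * K)) :
  raw_map iota (raw_add E p q) =
  raw_add (base_change iota E) (raw_map iota p) (raw_map iota q).
Proof.
case: p q => [[x1 y1]|] [[x2 y2]|] //=.
rewrite -rmorphN !(inj_eq (fmorph_inj iota)).
have third l : raw_map iota (Some (raw_third E x1 y1 x2 l)) =
    Some (raw_third (base_change iota E) (iota x1) (iota y1) (iota x2) (iota l)).
  by rewrite /raw_third /= !(rmorphN, rmorphD, rmorphM, rmorphXn).
case: ifP => _; first case: ifP => _ //.
  by rewrite third fmorph_div rmorphMn /ec_cubic_deriv !(rmorphD, rmorphN, rmorphM).
by rewrite third fmorph_div !rmorphB.
Qed.

Lemma ec_map_zmod_morphism : zmod_morphism (@ec_map K L iota E).
Proof.
move=> P Q; apply: (canRL (addrK _)); apply: val_inj => /=.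
by rewrite -raw_map_add -[raw_add _ _ _]/(ecval (P - Q + Q)) subrK.
Qed.

HB.instance Definition _ :=
  GRing.isZmodMorphism.Build _ _ (@ec_map K L iota E) ec_map_zmod_morphism.

Lemma ec_map_inj : injective (@ec_map K L iota E).
Proof.
move=> [p hp] [q hq] /(congr1 (@ecval _ _)) /= epq; apply: val_inj => /=.
case: p q {hp hq} epq => [[x y]|] [[x' y']|] //= [] /fmorph_inj -> /fmorph_inj ->.
by [].
Qed.

End Curve.

(** * Geometric torsion comes from Z/4 + Z/4 *)

Section Torsion.

Variables (K : fieldType) (E : ellcurve K) (Q1 Q2 : ecpoint E).
Hypotheses (hQ1 : ecval (Q1 *+ 2) = Some (ec1 E, 0)).
Hypotheses (hQ2 : ecval (Q2 *+ 2) = Some (ec2 E, 0)).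
Variable phi : {additive ('Z_4 * 'Z_4)%type -> ecpoint E}.
Hypotheses (phi1 : phi (1, 0) = Q1) (phi2 : phi (0, 1) = Q2).

(** Exhibiting [R] as the image of a double serves both divisibility by 2 and the descent from
    4-torsion to 2-torsion. *)
Lemma ec_torsion2_image (L : fieldType) (iota : {rmorphism K -> L})
    (R : ecpoint (base_change iota E)) :
  R *+ 2 = 0 -> exists u, ec_map iota (phi u *+ 2) = R.
Proof.
have eqR P : raw_map iota (ecval P) = ecval R -> ec_map iota P = R.
  by move=> eP; apply: val_inj.
move/ec_torsion2; rewrite !inE => /or4P[] /eqP hR.
- by exists 0; apply: eqR; rewrite raddf0 mul0rn hR.
- by exists (1, 0); apply: eqR; rewrite phi1 hQ1 hR /= rmorph0.
- by exists (0, 1); apply: eqR; rewrite phi2 hQ2 hR /= rmorph0.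
exists ((1, 0) + (0, 1)); apply: eqR; rewrite raddfD phi1 phi2 mulrnDl.
by rewrite (ec_add_order2 hQ1 hQ2) hR /= rmorph0.
Qed.

Lemma ec_torsion4_image (L : fieldType) (iota : {rmorphism K -> L})
    (R : ecpoint (base_change iota E)) :
  R *+ 4 = 0 -> exists u, ec_map iota (phi u) = R.
Proof.
rewrite (mulrnA R 2 2) => /ec_torsion2_image[u hu].
have /ec_torsion2_image[u' hu'] : (R - ec_map iota (phi u)) *+ 2 = 0.
  by rewrite mulrnBl -hu raddfMn subrr.
by exists (u' *+ 2 + u); rewrite (raddfD phi) raddfD (raddfMn phi) /= hu' subrK.
Qed.

End Torsion.

(** Since 4 kills the group, order 4 means nonzero double, which excludes 4 of the 16 elements. *)
Lemma Z4Z4_order4 :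
  exists s : seq ('Z_4 * 'Z_4),
    [/\ uniq s, size s = 12%N & forall u, u \in s <-> has_order u 4].
Proof.
pose r := [seq inZp k : 'Z_4 | k <- iota 0 4].
exists [seq u <- [seq (m, n) | m <- r, n <- r] | u *+ 2 != 0]; split=> //.
move=> [m n]; rewrite has_order4P mem_filter allpairs_f ?andbT; last 2 first.
- by case: m => [[|[|[|[|]]]]].
- by case: n => [[|[|[|[|]]]]].
split=> [h|[]] //; split=> //.
by case: m n {h} => [[|[|[|[|]]]] // hm] [[|[|[|[|]]]] // hn]; apply/eqP.
Qed.

Lemma Eab_halves (K : fieldType) (i a b : K)
    (charK : 2%N \notin [pchar K]) (hi : i ^+ 2 = -1)
    (a0 : a != 0) (b0 : b != 0) (hab : a != b) (haNb : a != - b)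
    (haib : a != i * b) (haNib : a != - (i * b)) :
  let E := Eab charK hi a0 b0 hab haNb haib haNib in
  exists Q1 Q2 : ecpoint E,
    ecval (Q1 *+ 2) = Some (ec1 E, 0) /\ ecval (Q2 *+ 2) = Some (ec2 E, 0).
Proof.
move=> E; have uE := ec_uniq E.
(* Here alpha_1 - alpha_2 = -4 a^2 b^2 = (2 i a b)^2; this is where a square root of -1 enters. *)
have [|||||Q1 hQ1] := @ec_halve _ E (ec1 E) (ec2 E) (ec3 E)
  (2%:R * i * a * b) (a ^+ 2 - b ^+ 2) _ _ _ _ _ uE; rewrite //=.
- by rewrite !exprMn hi; ring.
- by rewrite subr0.
have [||||||Q2 hQ2] := @ec_halve _ E (ec2 E) (ec1 E) (ec3 E)
  (2%:R * a * b) (a ^+ 2 + b ^+ 2); rewrite /=; try ring.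
  exact: etrans (uniq_catCA [:: _] [:: _] [:: _]) uE.
by exists Q1, Q2.
Qed.

Theorem theorem5p6 (K : fieldType) (i a b : K)
    (charK : 2%N \notin [pchar K]) (hi : i ^+ 2 = -1)
    (a0 : a != 0) (b0 : b != 0) (hab : a != b) (haNb : a != - b)
    (haib : a != i * b) (haNib : a != - (i * b)) :
  let E : ellcurve K := Eab charK hi a0 b0 hab haNb haib haNib in
  [/\ (* every point of order 2 in E(K) is divisible by 2 in E(K) ... *)
      forall P : ecpoint E, has_order P 2 ->
        exists Q : ecpoint E, Q *+ 2 = P,
      (* ... and so is every geometric point of order 2 *)
      forall (L : fieldType) (iota : {rmorphism K -> L})
             (R : ecpoint (base_change iota E)), has_order R 2 ->
        exists Q : ecpoint E, ec_map iota (Q *+ 2) = R,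
      (* E(K) has exactly twelve points of order 4 ... *)
      exists s : seq (ecpoint E),
        [/\ uniq s, size s = 12%N &
            forall P : ecpoint E, P \in s <-> has_order P 4],
      (* ... and every geometric point of order 4 is one of them *)
      forall (L : fieldType) (iota : {rmorphism K -> L})
             (R : ecpoint (base_change iota E)), has_order R 4 ->
        exists P : ecpoint E, has_order P 4 /\ ec_map iota P = R &
      (* E(K) contains a subgroup isomorphic to Z/4 + Z/4 *)
      exists phi : {additive ('Z_4 * 'Z_4)%type -> ecpoint E},
        injective phi].
Proof.
move=> E; have [Q1 [Q2 [hQ1 hQ2]]] := Eab_halves charK hi a0 b0 hab haNb haib haNib.
rewrite -/E in Q1 Q2 hQ1 hQ2.
have double0 e (P : ecpoint E) : ecval P = Some (e, 0) -> P *+ 2 = 0.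
  by move=> hP; apply: val_inj; rewrite mulr2n /= hP /= oppr0 !eqxx.
have neq0 e (P : ecpoint E) : ecval P = Some e -> P != 0.
  by move=> hP; apply/eqP => P0; rewrite P0 in hP.
have [phi [phi_inj phi1 phi2]] := Z4Z4_embedding
  (etrans (mulrnA Q1 2 2) (double0 _ _ hQ1)) (etrans (mulrnA Q2 2 2) (double0 _ _ hQ2))
  (neq0 _ _ hQ1) (neq0 _ _ hQ2) (neq0 _ _ (ec_add_order2 hQ1 hQ2)).
have tor2 := ec_torsion2_image hQ1 hQ2 phi1 phi2.
have tor4 := ec_torsion4_image hQ1 hQ2 phi1 phi2.
split; last by exists phi.
(* Rational points are handled as geometric points over [K] itself, and injectivity of [ec_map]
   brings the result back to [E]. *)
- move=> P [_ P2 _]; have [|u] := tor2 K idfun (ec_map idfun P).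
    by rewrite -raddfMn P2 raddf0.
  by move=> /ec_map_inj hu; exists (phi u).
- by move=> L iota R [_ /tor2[u hu] _]; exists (phi u).
- have [s [us ss hs]] := Z4Z4_order4; exists (map phi s); split.
  + by rewrite map_inj_uniq.
  + by rewrite size_map.
  move=> P; split=> [/mapP[u /hs hu ->]|hP]; first by rewrite has_order_inj.
  have [_ P4 _] := hP; have [|u /ec_map_inj hu] := tor4 K idfun (ec_map idfun P).
    by rewrite -raddfMn P4 raddf0.
  by rewrite -hu map_f // hs -(has_order_inj _ _ phi_inj) hu.
- move=> L iota R hR; have [_ /tor4[u hu] _] := hR; exists (phi u); split=> //.
  by rewrite -hu in hR; apply/(has_order_inj _ _ (@ec_map_inj _ E _ iota)).
Qed.
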